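(* Suppose every IDR of the system $\mathcal{I}(E,\mathcal{F}(E))$ is of Restricted Case I form. Then the optimization version of the Entity Hardening problem — given $E'\subseteq E$ with $|E'|=K$ and an integer $k<K$, find $H\subseteq E$ with $|H|\le k$ maximizing the number $|\mathrm{KillSet}(E')\setminus F(E',H)|$ of protected entities — can be solved optimally in time polynomial in $n=|E|$.
   Context: A system $\mathcal{I}(E,\mathcal{F}(E))$ consists of a finite set $E$ of entities, $n=|E|$, and a set $\mathcal{F}(E)$ of interdependency relations (IDRs). Each entity $e$ has at most one IDR, of the form $e\leftarrow \sum_{i=1}^{m}\prod_{x\in s_i}x$ (a disjunction of conjunctions), where each minterm $s_i$ is a nonempty subset of $E$; it means $e$ is operational only if for at least one minterm all entities of that minterm are operational. Entities without an IDR can only fail initially. Failure dynamics: given an initially failing set $E'\subseteq E$ and a set $H\subseteq E$ of hardened entities (hardened entities never fail), put $F_0=E'\setminus H$ and $F_{t+1}=F_t\cup\{e\in E\setminus H: e \text{ has an IDR and every minterm of it contains an element of } F_t\}$; the final failed set is $F(E',H):=F_{n-1}$. $\mathrm{KillSet}(E'):=F(E',\emptyset)$. Restricted Case I: every IDR consists of a single minterm of size one, i.e. has the form $e_i\leftarrow e_j$ with $e_j\in E$. *)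

(* Defs.v *)
From mathcomp Require Import all_boot.
Set Implicit Arguments. Unset Strict Implicit. Unset Printing Implicit Defensive.

(* An IDR is a nonempty-or-not list of minterms (subsets of E),       *)
(* read as a disjunction of conjunctions; None = the entity has no IDR.*)
Definition system (n : nat) := 'I_n -> option (seq {set 'I_n}).

Definition caseI n (S : system n) : Prop :=
  forall i, match S i with
            | None => True
            | Some ms => exists j : 'I_n, ms = [:: [set j]]
            end.

Definition fail_step n (S : system n) (H F : {set 'I_n}) : {set 'I_n} :=
  F :|: [set e | (e \notin H) &&
                 (if S e is Some ms then all (fun s => s :&: F != set0) ms
                  else false)].

Definition Ffail n (S : system n) (E' H : {set 'I_n}) : {set 'I_n} :=
  iter n.-1 (fail_step S H) (E' :\: H).

Definition KillSet n (S : system n) (E' : {set 'I_n}) : {set 'I_n} :=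
  Ffail S E' set0.

Definition protected n (S : system n) (E' H : {set 'I_n}) : nat :=
  #|KillSet S E' :\: Ffail S E' H|.

Definition optimal_hardening n (S : system n) (E' : {set 'I_n}) (k : nat)
  (H : {set 'I_n}) : Prop :=
  #|H| <= k /\
  forall H' : {set 'I_n}, #|H'| <= k -> protected S E' H' <= protected S E' H.

(* Model of computation: unit-cost RAM (unbounded natural registers,  *)
(* indirect addressing, addition and truncated subtraction only).     *)
Inductive instr : Type :=
| IConst of nat & nat
| IAdd of nat & nat & nat
| ISub of nat & nat & nat
| ILoad of nat & nat
| IStore of nat & nat
| IJz of nat & nat
| IJmp of nat
| IHalt.

Definition upd (m : nat -> nat) (a v : nat) : nat -> nat :=
  fun x => if x == a then v else m x.

Definition exec (i : instr) (pc : nat) (m : nat -> nat) : nat * (nat -> nat) :=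
  match i with
  | IConst r c => (pc.+1, upd m r c)
  | IAdd d a b => (pc.+1, upd m d (m a + m b))
  | ISub d a b => (pc.+1, upd m d (m a - m b))
  | ILoad d a => (pc.+1, upd m d (m (m a)))
  | IStore a s => (pc.+1, upd m (m a) (m s))
  | IJz r l => (if m r == 0 then l else pc.+1, m)
  | IJmp l => (l, m)
  | IHalt => (pc, m)
  end.

(* run fuel p pc m = Some m' iff program p, started at pc with memory m,
   halts (reaches IHalt or leaves the program) after at most fuel steps,
   with final memory m'. *)
Fixpoint run (fuel : nat) (p : seq instr) (pc : nat) (m : nat -> nat)
  : option (nat -> nat) :=
  match nth IHalt p pc with
  | IHalt => Some m
  | ins => match fuel with
           | 0 => None
           | f.+1 => let (pc', m') := exec ins pc m in run f p pc' m'
           end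
  end.

(* Input encoding of a Case I instance:
     cell 0       = n
     cell 1       = k
     cell 2+i     = 0 if e_i has no IDR, j+1 if its IDR is e_i <- e_j  (i < n)
     cell 2+n+i   = 1 if e_i \in E', 0 otherwise                       (i < n)
     all other cells = 0.                                                   *)
Definition parent_code n (S : system n) (i : 'I_n) : nat :=
  match S i with
  | Some [:: s] => if [pick x in s] is Some j then (nat_of_ord j).+1 else 0
  | _ => 0
  end.

Definition init_mem n (S : system n) (E' : {set 'I_n}) (k : nat) : nat -> nat :=
  fun a =>
    if a == 0 then n
    else if a == 1 then k
    else if (2 <= a) && (a < 2 + n) then
      (if @insub _ (fun x => x < n) 'I_n (a - 2) is Some i then parent_code S i else 0)
    else if (2 + n <= a) && (a < 2 + n + n) then
      (if @insub _ (fun x => x < n) 'I_n (a - (2 + n)) is Some i then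
         nat_of_bool (i \in E') else 0)
    else 0.

Definition H_out (n : nat) (m : nat -> nat) : {set 'I_n} :=
  [set i : 'I_n | m (2 + n + n + i) != 0].

(* Main.v *)
Require Import Defs.
From mathcomp Require Import all_boot.
From mathcomp Require Import zify.
Set Implicit Arguments. Unset Strict Implicit. Unset Printing Implicit Defensive.

(* In Case I every entity has at most one parent, so failures travel down a   *)
(* functional graph. Climbing from an entity v of the kill set, let its       *)
(* origin be the first element of E' met. The only failure that can reach v   *)
(* first passes through its origin, so v survives exactly when H meets the    *)
(* path from v to its origin. Hardening the origin itself protects everything *)
(* with that origin; hence an optimal H consists of the k elements of E' that *)
(* are the origin of most entities, and these are found greedily.             *)

(** * Origins and weights *)

(** Write the weight of an element of [E'] for the number of entities with that origin. Up to
    replacing hardened entities by their origins, the objective is additive: for any [H'] within the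
    budget, [protected_weight] yields [A] with |A| at most |H'| such that [protected H'] is at most
    the weight of [A]; this is at most the weight of a heaviest [H], and by [weight_protected] at
    most [protected H]. So [heaviest_optimal] reduces the problem to picking the k largest weights,
    which [heaviestS] does one at a time.

    For the time bound, a RAM program computes each origin by n climbing steps, tallies the weights
    and selects k maxima, all in O(n^2) steps since k < n. The rules for [wp] prove result and step
    count together, and [hardeningP] composes the phases. *)

Section Dynamics.
Variables (n : nat) (S : system n) (E' : {set 'I_n}).
Hypothesis S1 : caseI S.

Definition parent (i : 'I_n) : option 'I_n :=
  if S i is Some [:: s] then [pick x in s] else None.

Lemma mem_fail_step (H F : {set 'I_n}) e :
  (e \in fail_step S H F) =
  (e \in F) || (e \notin H) && (if parent e is Some j then j \in F else false).
Proof.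
rewrite /fail_step !inE /parent; congr (_ || _ && _).
have := S1 e; case: (S e) => // ms [j ->] /=.
case: pickP => [x|/(_ j)]; last by rewrite inE eqxx.
rewrite inE andbT => /eqP ->; apply/set0Pn/idP => [[y]|jF].
  by rewrite !inE => /andP[/eqP ->].
by exists j; rewrite !inE eqxx.
Qed.

Lemma fail_stepS (H F : {set 'I_n}) : F \subset fail_step S H F.
Proof. exact: subsetUl. Qed.

(* The chain of failed sets grows strictly until it is stationary, and it     *)
(* starts at an empty (already stationary) or nonempty set, so n - 1 steps    *)
(* suffice.                                                                   *)
Lemma Ffail_fixed (H : {set 'I_n}) :
  fail_step S H (Ffail S E' H) = Ffail S E' H.
Proof.
pose A t := iter t (fail_step S H) (E' :\: H).
rewrite /Ffail -/(A _) -[fail_step _ _ _]/(A n.-1.+1).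
have [A0|A0] := eqVneq (A 0) set0.
  suff A_set0 t : A t = set0 by rewrite !A_set0.
  elim: t => // t IHt; apply/setP => e.
  rewrite -[A _]/(fail_step S H (A t)) IHt mem_fail_step !inE.
  by case: parent => [j|]; rewrite ?inE andbF.
have grow t : A t.+1 = A t \/ t.+1 < #|A t.+1|.
  elim: t => [|t [eqA|ltA]].
  - have [->|neqA] := eqVneq (A 1) (A 0); [by left|right].
    have ltA : A 0 \proper A 1 by rewrite properEneq eq_sym neqA fail_stepS.
    by apply: leq_ltn_trans (proper_card ltA); rewrite card_gt0.
  - by left; rewrite -[LHS]/(fail_step S H (A t.+1)) eqA.
  - have [->|neqA] := eqVneq (A t.+2) (A t.+1); [by left|right].
    have pA : A t.+1 \proper A t.+2 by rewrite properEneq eq_sym neqA fail_stepS.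
    exact: leq_ltn_trans ltA (proper_card pA).
(* A strict step this late would put more than [n] elements into a subset of ['I_n]. *)
case: (grow n.-1) => // ltA.
have := leq_trans ltA (max_card _); rewrite card_ord; lia.
Qed.

Lemma Ffail_closed (H : {set 'I_n}) e j :
  e \notin H -> parent e = Some j -> j \in Ffail S E' H -> e \in Ffail S E' H.
Proof. by move=> eH pe jF; rewrite -Ffail_fixed mem_fail_step eH pe jF orbT. Qed.

Lemma Ffail_init (H : {set 'I_n}) : E' :\: H \subset Ffail S E' H.
Proof.
rewrite /Ffail; elim: n.-1 => // t IHt.
exact: subset_trans IHt (fail_stepS _ _).
Qed.

Lemma Ffail_hardened (H : {set 'I_n}) e : e \in Ffail S E' H -> e \notin H.
Proof.
rewrite /Ffail; elim: n.-1 => [|t IHt] /=; first by rewrite inE => /andP[].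
by rewrite mem_fail_step => /orP[/IHt|/andP[]].
Qed.

Lemma Ffail_parent (H : {set 'I_n}) e : e \in Ffail S E' H -> e \notin E' ->
  exists2 j, parent e = Some j & j \in Ffail S E' H.
Proof.
move=> eF eE; move: eF; rewrite {1}/Ffail.
(* Only the time at which [e] fails varies; its parent enters the final set by monotonicity. *)
suff main t : t <= n.-1 -> e \in iter t (fail_step S H) (E' :\: H) ->
  exists2 j, parent e = Some j & j \in Ffail S E' H by exact: main.
elim: t => [|t IHt] lt_t /=; first by rewrite inE (negbTE eE) andbF.
rewrite mem_fail_step => /orP[|/andP[_]]; first exact/IHt/ltnW.
case: parent => // j jF; exists j => //.
rewrite /Ffail -(subnK (ltnW lt_t)); elim: (_ - _) => //= d.
exact/subsetP/fail_stepS.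
Qed.

(* Elements of E' are made fixed points of [climb], so that [iter] stops at   *)
(* the first one; on a cycle avoiding E', [origin] has a junk value.          *)
Definition climb (o : option 'I_n) : option 'I_n :=
  if o is Some i then if i \in E' then Some i else parent i else None.

Definition origin (v : 'I_n) := iter n climb (Some v).

Lemma climb_id s i : i \in E' -> iter s climb (Some i) = Some i.
Proof. by move=> iE; elim: s => //= s ->; rewrite /= iE. Qed.

Lemma climb_None s : iter s climb None = None.
Proof. by elim: s => //= s ->. Qed.

Lemma climb_uniq s t i j o : i \in E' -> j \in E' ->
  iter s climb o = Some i -> iter t climb o = Some j -> i = j.
Proof.
move=> iE jE si tj; apply: Some_inj.
have [st|/ltnW st] := leqP s t.
  by rewrite -tj -(subnK st) iterD si climb_id.
by rewrite -si -(subnK st) iterD tj climb_id.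
Qed.

Lemma climb_kill s v i : i \in E' -> iter s climb (Some v) = Some i ->
  v \in KillSet S E'.
Proof.
move=> iE; have initP := subsetP (Ffail_init set0).
elim: s v => [|s IHs] v; first by case=> ->; apply: initP; rewrite !inE.
rewrite iterSr /=; have [vE _|vE] := boolP (v \in E').
  by apply: initP; rewrite !inE.
case pv: (parent v) => [u|]; last by rewrite climb_None.
by move=> /IHs; apply: Ffail_closed pv; rewrite inE.
Qed.

Lemma kill_origin v : v \in KillSet S E' -> exists2 i, i \in E' & origin v = Some i.
Proof.
rewrite /KillSet /Ffail.
have main t u : u \in iter t (fail_step S set0) (E' :\: set0) ->
    exists2 i, i \in E' & iter t climb (Some u) = Some i.
  elim: t u => [|t IHt] u /=; first by rewrite !inE /= => uE; exists u.
  rewrite mem_fail_step => /orP[/IHt[i iE ->]|/andP[_]].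
    by exists i => //=; rewrite iE.
  case pu: (parent u) => [w|] // /IHt[i iE wi].
  have [uE|uE] := boolP (u \in E').
    by exists u => //; apply: (@climb_id t.+1).
  by exists i => //; rewrite -iterS iterSr /= (negbTE uE) pu.
move=> /main[i iE vi]; exists i => //.
(* The climb is already in [E'] after n - 1 steps, and the n-th step of [origin] fixes it. *)
have n_gt0 : 0 < n by case: v {vi} => v; case: n.
by rewrite /origin -[X in iter X](prednK n_gt0) iterS vi /= iE.
Qed.

Lemma climb_fail (H : {set 'I_n}) s v i : v \in Ffail S E' H ->
  iter s climb (Some v) = Some i -> i \in Ffail S E' H.
Proof.
elim: s v => [|s IHs] v vF; first by case=> <-.
rewrite iterSr /=; have [vE|vE] := boolP (v \in E'); first exact: IHs.
by have [j -> jF] := Ffail_parent vF vE; apply: IHs.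
Qed.

(** A survivor that is not hardened lies outside [E'] and has a surviving parent, so climbing
    continues through survivors until a hardened one is met, at the latest at [i]. Uniqueness of the
    point of [E'] reached gives it the origin [i]. *)
Lemma climb_avoid (H : {set 'I_n}) s v i : i \in E' ->
  iter s climb (Some v) = Some i -> v \notin Ffail S E' H ->
  exists2 h, h \in H & origin h = Some i.
Proof.
move=> iE; elim: s v => [|s IHs] v.
  case=> ->; have [iH _|iH /negP[]] := boolP (i \in H).
    by exists i => //; apply: climb_id.
  by apply: (subsetP (Ffail_init H)); rewrite inE iH.
move=> vi vF; have [vH|vH] := boolP (v \in H).
  have [j jE rj] := kill_origin (climb_kill iE vi).
  by exists v => //; rewrite rj (climb_uniq jE iE rj vi).
move: vi; rewrite iterSr /=; have [vE|vE] := boolP (v \in E').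
  by case/negP: vF; apply: (subsetP (Ffail_init H)); rewrite inE vH.
case pv: (parent v) => [u|]; last by rewrite climb_None.
move=> /IHs; apply; apply: contra vF; exact: Ffail_closed vH pv.
Qed.

(** * Weights of origins, and the two bounds on the number of protected entities *)

(** The factor [i \in E'] discards junk origins, so only entities of the kill set are counted. *)
Definition weight (i : 'I_n) : nat :=
  \sum_(v : 'I_n) ((origin v == Some i) && (i \in E')).

(** An entity has a single origin, so the classes counted by different weights are disjoint. *)
Lemma weight_sum (A : {set 'I_n}) : \sum_(i in A) weight i =
  #|[set v | if origin v is Some i then (i \in A) && (i \in E') else false]|.
Proof.
rewrite -sum1dep_card [RHS]big_mkcond /weight exchange_big /=; apply: eq_bigr => v _.
case: (origin v) => [j|]; last by rewrite big1.
have [jA|jA] /= := boolP (j \in A).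
  rewrite (bigD1 j) //= eqxx big1 ?addn0 => [|i /andP[_]]; first by case: (_ \in _).
  by rewrite (inj_eq Some_inj) eq_sym => /negbTE ->.
rewrite big1 // => i iA; case: eqP => // -[ji].
by rewrite ji iA in jA.
Qed.

Lemma weight_protected (H : {set 'I_n}) :
  \sum_(i in H) weight i <= protected S E' H.
Proof.
rewrite weight_sum; apply/subset_leq_card/subsetP => v; rewrite !inE.
case rv: (origin v) => [i|] // /andP[iH iE].
rewrite (climb_kill iE rv) andbT; apply/negP => /climb_fail/(_ rv).
by move=> /Ffail_hardened/negP.
Qed.

Lemma protected_weight (H : {set 'I_n}) :
  exists2 A : {set 'I_n}, #|A| <= #|H| & protected S E' H <= \sum_(i in A) weight i.
Proof.
(* Each hardened entity is replaced by its origin; the default [h] is harmless, as only those with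
   an origin in [E'] are used below. *)
exists [set odflt h (origin h) | h in H]; first exact: leq_imset_card.
rewrite weight_sum; apply/subset_leq_card/subsetP => v; rewrite !inE.
case/andP=> vF /kill_origin[i iE rv]; rewrite rv iE andbT.
have [h hH rh] := climb_avoid iE rv vF.
by apply/imsetP; exists h; rewrite ?rh.
Qed.

(** * Greedy choice of the heaviest origins *)

Definition heaviest (j : nat) (H : {set 'I_n}) : Prop :=
  #|H| <= j /\ forall A : {set 'I_n}, #|A| <= j ->
    \sum_(i in A) weight i <= \sum_(i in H) weight i.

Lemma heaviest_optimal k H : heaviest k H -> optimal_hardening S E' k H.
Proof.
case=> Hk maxH; split=> // H' H'k.
have [A AH' /leq_trans->//] := protected_weight H'.
exact: leq_trans (maxH _ (leq_trans AH' H'k)) (weight_protected H).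
Qed.

Lemma heaviest0 : heaviest 0 set0.
Proof.
by split=> [|A]; rewrite ?cards0 // leqn0 cards_eq0 => /eqP->.
Qed.

(* Exchange: a competing set leaving H has an element y outside H; y weighs   *)
(* at most as much as x, and the rest of the set at most as much as H.        *)
Lemma heaviestS j H x : heaviest j H ->
  (forall i, (i \notin H) * weight i <= (x \notin H) * weight x) ->
  heaviest j.+1 (x |: H).
Proof.
move=> [Hj maxH] maxx; split=> [|A Aj].
  by rewrite cardsU1; case: (x \in H); lia.
have [AH|/subsetPn[y yA yH]] := boolP (A \subset H).
  rewrite [leqLHS]big_mkcond [leqRHS]big_mkcond; apply: leq_sum => i _; rewrite !inE.
  by have /implyP := subsetP AH i; case: (i \in A); case: (i \in H); rewrite ?orbT.
have leA : \sum_(i in A :\ y) weight i <= \sum_(i in H) weight i.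
  by apply: maxH; have := cardsD1 y A; rewrite yA; lia.
rewrite (big_setD1 y) //=; apply: leq_trans (leq_add (leqnn _) leA) _.
(* If [x] is already in [H], the bound forces [y] to have weight 0. *)
have := maxx y; rewrite yH mul1n; have [xH|xH] := boolP (x \in H).
  by rewrite leqn0 => /eqP ->; rewrite (setUidPr _) // sub1set.
by rewrite big_setU1 //= mul1n leq_add2r.
Qed.

End Dynamics.

(** * Structured programming on the RAM *)

Definition memory := nat -> nat.
(* Jump targets are absolute, so a code block is a function of its address.   *)
Definition code := nat -> seq instr.

Definition embeds (p : seq instr) (o : nat) (s : seq instr) : Prop :=
  forall i, i < size s -> nth IHalt p (o + i) = nth IHalt s i.

(* [wp c T Q m]: wherever [c] is placed in a program, started in [m] it falls *)
(* through to its end within [T] steps, in a memory satisfying [Q].           *)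
Definition wp (c : code) (T : nat) (Q : memory -> Prop) (m : memory) : Prop :=
  forall p o, embeds p o (c o) ->
  exists t m', [/\ t <= T, Q m' &
    forall f, run (t + f) p o m = run f p (o + size (c o)) m'].

Definition straight (i : instr) : bool :=
  match i with IJz _ _ | IJmp _ | IHalt => false | _ => true end.

Definition ops (s : seq instr) : code := fun _ => s.
Definition seqc (c1 c2 : code) : code :=
  fun o => let s := c1 o in s ++ c2 (o + size s).
Definition whilec (r : nat) (c : code) : code :=
  fun o => let s := c o.+1 in IJz r (o + size s).+2 :: rcons s (IJmp o).
(** The only test jumps on zero, so the body is the jump target and the fall-through skips it. *)
Definition ifz (r : nat) (c : code) : code :=
  fun o => let s := c o.+2 in [:: IJz r o.+2, IJmp (o.+2 + size s) & s].
(** Unrolled when the program is built: no counter register is needed, and the copies may use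
    different addresses. *)
Fixpoint repeatc (q : nat) (c : nat -> code) : code :=
  if q is q'.+1 then seqc (repeatc q' c) (c q') else ops [::].

Lemma embeds_catl p o s1 s2 : embeds p o (s1 ++ s2) -> embeds p o s1.
Proof.
move=> emb i lti; rewrite emb ?nth_cat ?lti // size_cat.
exact: ltn_addr.
Qed.

Lemma embeds_catr p o s1 s2 : embeds p o (s1 ++ s2) -> embeds p (o + size s1) s2.
Proof.
move=> emb i lti; rewrite -addnA emb ?size_cat ?ltn_add2l // nth_cat.
by rewrite ltnNge leq_addr addKn.
Qed.

Lemma embeds_cons p o i s : embeds p o (i :: s) ->
  nth IHalt p o = i /\ embeds p o.+1 s.
Proof.
move=> emb; split; first by rewrite -[o in LHS]addn0 emb.
by rewrite -addn1; apply: (@embeds_catr p o [:: i]).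
Qed.

(** * Rules for the result and running time of code blocks *)

Lemma wp_weaken T (c : code) T' Q m : T <= T' -> wp c T Q m -> wp c T' Q m.
Proof.
by move=> leT H p o /H[t [m' [tT Qm' r]]]; exists t, m'; split=> //; exact: leq_trans leT.
Qed.

Lemma wp_conseq (Q : memory -> Prop) c T (Q' : memory -> Prop) m :
  wp c T Q m -> (forall m', Q m' -> Q' m') -> wp c T Q' m.
Proof.
by move=> H QQ' p o /H[t [m' [tT Qm' r]]]; exists t, m'; split=> //; apply: QQ'.
Qed.

Lemma wp_nil (Q : memory -> Prop) T m : Q m -> wp (ops [::]) T Q m.
Proof. by move=> Qm p o _; exists 0, m; split=> // f; rewrite addn0. Qed.

(** The address 0 given to [exec] is arbitrary: the memory effect does not depend on it. *)
Lemma wp_cons i s (Q : memory -> Prop) T m : straight i ->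
  wp (ops s) T Q (exec i 0 m).2 -> wp (ops (i :: s)) T.+1 Q m.
Proof.
move=> si H p o /embeds_cons[pi /H[t [m' [tT Qm' r]]]].
exists t.+1, m'; split=> // f; rewrite [size _]/= addnS -addSn -r addSn /= pi.
by clear pi; case: i si H r.
Qed.

Lemma wp_seq T1 T2 c1 c2 (Q : memory -> Prop) T m : T1 + T2 <= T ->
  wp c1 T1 (wp c2 T2 Q) m -> wp (seqc c1 c2) T Q m.
Proof.
move=> leT H p o emb.
have [t1 [m1 [le1 H1 r1]]] := H p o (embeds_catl emb).
have [t2 [m2 [le2 H2 r2]]] := H1 p _ (embeds_catr emb).
exists (t1 + t2), m2; split=> // [|f]; first by lia.
by rewrite -addnA r1 r2 size_cat addnA.
Qed.

Lemma wp_ifz r c (Q : memory -> Prop) T m :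
  (m r = 0 -> wp c T Q m) -> (m r <> 0 -> Q m) -> wp (ifz r c) T.+2 Q m.
Proof.
move=> H0 H1 p o /embeds_cons[pz /embeds_cons[pj emb]].
have [m0|/eqP m0] := eqVneq (m r) 0.
  have [t [m' [tT Qm' run']]] := H0 m0 _ _ emb.
  exists t.+1, m'; split=> // [|f]; first exact: leqW.
  by rewrite addSn /= pz /= m0 run' !addnS !addSn.
exists 2, m; split=> // [|f]; first exact: H1.
by rewrite /= pz /=; move/eqP/negbTE: m0 => ->; rewrite pj /= !addnS !addSn.
Qed.

(** The index of [I] counts the passes left. A pass costs the body, the test and the jump back; the
    last test costs one more step. *)
Lemma wp_while (I : nat -> memory -> Prop) N r c T m :
  (forall m', I 0 m' -> m' r = 0) ->
  (forall j m', I j.+1 m' -> m' r <> 0 /\ wp c T (I j) m') ->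
  I N m -> wp (whilec r c) (N * T.+2).+1 (I 0) m.
Proof.
move=> I0 IS; elim: N m => [|N IHN] m Im p o emb.
  have [pz _] := embeds_cons emb.
  exists 1, m; split=> // f; rewrite /= pz /= I0 //= size_rcons.
  by rewrite !addnS.
have [pz /[dup] emb1] := embeds_cons emb; rewrite -cats1 => /[dup] /embeds_catl embc.
move=> /embeds_catr/embeds_cons[pj _].
have [/eqP/negbTE m0 H] := IS _ _ Im.
have [t [m1 [le1 Im1 r1]]] := H _ _ embc.
have [t' [m2 [le2 Im2 r2]]] := IHN _ Im1 _ _ emb.
exists (t.+1 + t'.+1), m2; split=> // [|f]; first by rewrite mulSn; lia.
by rewrite -addnA addSn /= pz /= m0 r1 /= pj /= r2.
Qed.

Lemma wp_repeat (I : nat -> memory -> Prop) q (c : nat -> code) T m :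
  (forall j m', j < q -> I j m' -> wp (c j) T (I j.+1) m') ->
  I 0 m -> wp (repeatc q c) (q * T) (I q) m.
Proof.
elim: q => [|q IHq] H I0 /=; first exact: wp_nil.
apply: (@wp_seq (q * T) T); first by rewrite mulSn addnC.
apply: wp_conseq (IHq _ I0) _ => [j m' jq|m' Iq]; first by apply: H; exact: ltnW.
exact: H.
Qed.

(** Falling off the end of the program reads the default [IHalt]. *)
Lemma wp_run c T (Q : memory -> Prop) m F : T <= F -> wp c T Q m ->
  exists2 m', run F (c 0) 0 m = Some m' & Q m'.
Proof.
move=> TF H; have [i //|t [m' [tT Qm' r]]] := H (c 0) 0.
exists m' => //; rewrite -(subnKC (leq_trans tT TF)) r.
by rewrite add0n; case: (F - t) => [|f] /=; rewrite nth_default.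
Qed.

Lemma upd_same m a v x : x = a -> upd m a v x = v.
Proof. by move=> ->; rewrite /upd eqxx. Qed.

Lemma upd_neq m a v x : x != a -> upd m a v x = m x.
Proof. by rewrite /upd => /negbTE ->. Qed.

(** * The machine program *)

(* For large n every cell with a constant address holds input, so cells 2..15 *)
(* must be moved away before they can serve as registers. Only cells 0 and 1, *)
(* holding n and k, are available for this: the base B = n + 15 (n + k),      *)
(* which is at least 16 n, is formed in cell 0 and n + k in cell 1, from      *)
(* which n and k can be recovered. Entities are coded by 1..n and "none" by   *)
(* 0; the cells are then B + x: parent of x, B + n + x: indicator of E',      *)
(* 2B + x: weight of x while x is not selected and 0 afterwards, 3B + x:      *)
(* indicator of H.                                                            *)
Definition spill : code :=
  seqc (ops [:: IAdd 1 1 0])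
  (seqc (repeatc 15 (fun _ => ops [:: IAdd 0 0 1]))
  (seqc (ops [:: IStore 0 1; IConst 1 1])
  (seqc (repeatc 14 (fun j => ops [:: IAdd 0 0 1; IStore 0 j.+2]))
  (seqc (ops [:: IConst 15 14; ISub 2 0 15; ILoad 7 2; IConst 15 0;
                 IStore 2 15; IAdd 3 2 15])
  (seqc (repeatc 15 (fun _ => ops [:: ISub 3 3 7]))
  (ops [:: ISub 7 7 3; IAdd 4 2 3; IAdd 5 2 2; IAdd 6 5 2])))))).

Definition relocate : code :=
  seqc (ops [:: IAdd 8 3 3; IConst 9 14; ISub 8 8 9; IAdd 10 2 9; IAdd 9 9 1])
  (whilec 8 (ops [:: ISub 8 8 1; IAdd 9 9 1; IAdd 10 10 1; ILoad 0 9; IStore 10 0])).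

Definition find_origin : code :=
  seqc (ops [:: IConst 0 0; IAdd 8 7 0; IAdd 9 3 0])
  (whilec 9 (seqc (ops [:: ISub 9 9 1; IAdd 10 4 8; ILoad 10 10])
                  (ifz 10 (ops [:: IAdd 11 2 8; ILoad 8 11])))).

Definition weigh : code :=
  seqc (ops [:: IConst 0 0; IAdd 12 7 0; IAdd 7 3 0])
  (seqc (whilec 7 (seqc find_origin
          (ops [:: IAdd 10 4 8; ILoad 10 10; IAdd 11 5 8; ILoad 0 11; IAdd 0 0 10;
                   IStore 11 0; ISub 7 7 1])))
  (ops [:: IAdd 7 12 7])).

Definition find_max : code :=
  seqc (ops [:: IConst 0 0; IConst 9 0; IConst 10 0; IAdd 8 3 0])
  (whilec 8 (seqc (ops [:: IAdd 11 5 8; ILoad 11 11; ISub 0 9 11])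
            (seqc (ifz 0 (ops [:: IAdd 9 11 0; IAdd 10 8 0]))
                  (ops [:: ISub 8 8 1])))).

Definition select : code :=
  whilec 7 (seqc find_max
    (ops [:: ISub 7 7 1; IConst 0 0; IAdd 11 5 10; IStore 11 0;
             IAdd 11 6 10; IStore 11 1])).

(* For small n the output overlaps the registers, but it never touches cells  *)
(* 0..3.                                                                      *)
Definition output : code :=
  seqc (ops [:: IAdd 0 6 7; IAdd 2 3 7; IAdd 1 1 3; IAdd 1 1 3])
  (whilec 2 (ops [:: IConst 3 1; ISub 2 2 3; IAdd 0 0 3; IAdd 1 1 3;
                     ILoad 3 0; IStore 1 3])).

(** Symbolic execution: reads are resolved through pending updates, with [lia] comparing
    addresses. *)
Ltac sx := repeat match goal with
  | H : ?m ?r = _ |- context [?m ?r] => is_var m; rewrite H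
  | |- context [?a + 0] => rewrite (addn0 a)
  | |- context [?a + ?b - ?b] => rewrite (addnK b a)
  | |- context [upd ?m ?a ?v ?x] =>
      first [ rewrite (@upd_same m a v x); [|solve [done | lia]]
            | rewrite (@upd_neq m a v x); [|solve [done | lia]] ]
  end.
Ltac step := apply: wp_cons; [done|]; cbn [exec snd]; sx.

(** * Correctness and running time of the program *)

Section Verification.
Variables (n : nat) (S : system n) (E' : {set 'I_n}) (k : nat).
Variable B : nat.
Hypotheses (kE : k < #|E'|) (BE : B = n + 15 * (n + k)).


Let k_ltn : k < n.
Proof. by apply: leq_trans kE _; rewrite -[leqRHS]card_ord max_card. Qed.

Lemma init_parent (i : 'I_n) : init_mem S E' k i.+2 = parent_code S i.
Proof.
have lti := ltn_ord i; rewrite /init_mem (_ : i.+2 < 2 + n) //= subn2 /=.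
by rewrite (_ : insub _ = Some i) //; exact: valK.
Qed.

Lemma init_initial (i : 'I_n) : init_mem S E' k (2 + n + i) = (i \in E').
Proof.
rewrite /init_mem [2 + n + i < 2 + n]ltnNge leq_addr andbF ltn_add2l ltn_ord /=.
by rewrite addKn (_ : insub _ = Some i) //; exact: valK.
Qed.

Lemma init_blank a : 2 + n + n <= a -> init_mem S E' k a = 0.
Proof.
move=> lea; rewrite /init_mem.
have -> : (a == 0) = false by lia.
have -> : (a == 1) = false by lia.
have -> : (a < 2 + n) = false by lia.
have -> : (a < 2 + n + n) = false by lia.
by rewrite !andbF.
Qed.

Definition spilled (m : memory) : Prop :=
  [/\ m 1 = 1, m 2 = B, m 3 = n, m 4 = B + n & m 5 = B + B] /\
  [/\ m 6 = B + B + B, m 7 = k, m B = 0,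
   forall x, 0 < x < 15 -> m (B + x) = init_mem S E' k x.+1 &
   forall a, 16 <= a < B \/ B + B <= a -> m a = init_mem S E' k a].

Lemma spillP : wp spill 100 spilled (init_mem S E' k).
Proof.
set m0 := init_mem S E' k.
have m00 : m0 0 = n by [].
have m01 : m0 1 = k by [].
apply: (@wp_seq 1 99) => //; step; apply: wp_nil; rewrite [k + n]addnC.
pose I1 j (m : memory) := [/\ m 0 = n + j * (n + k), m 1 = n + k &
  forall a, 2 <= a -> m a = m0 a].
apply: (@wp_seq (15 * 1) 84) => //.
apply: (@wp_conseq (I1 15)).
  apply: wp_repeat => [j m _ [e0 e1 ea]|]; last first.
    by split=> [||a le2]; sx => //; lia.
  step; apply: wp_nil; split=> [||a le2]; sx => //; rewrite ?ea //; lia.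
move=> m [e0 e1 ea]; rewrite -BE in e0.
apply: (@wp_seq 2 82) => //; step; step; apply: wp_nil.
pose I2 j (m : memory) := [/\ m 0 = B + j, m 1 = 1, m B = n + k,
  forall x, 0 < x < j.+1 -> m (B + x) = m0 x.+1 &
  forall a, 2 <= a < B \/ B + B <= a -> m a = m0 a].
apply: (@wp_seq (14 * 2) 54) => //.
apply: (@wp_conseq (I2 14)).
  apply: wp_repeat => [j m' lt14 [f0 f1 fB fx fa]|]; last first.
    split=> [|||x|a lea]; sx => //; try lia; rewrite ea //; lia.
  step; step; apply: wp_nil; split=> [|||x lex|a lea]; sx => //; try lia.
    have [->|ne] := eqVneq x j.+1.
      by rewrite -addn1 addnA; sx; rewrite fa //; lia.
    by sx; rewrite fx //; lia.
  by rewrite fa.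
move=> {e0 e1 ea}m [e0 e1 eB ex ea].
apply: (@wp_seq 6 48) => //; do 6!step; apply: wp_nil.
(* Subtracting n + k fifteen times from B leaves n. *)
pose I3 j (m : memory) := [/\ m 1 = 1, m 2 = B, m 3 = B - j * (n + k) & m 7 = n + k] /\
  [/\ m B = 0, forall x, 0 < x < 15 -> m (B + x) = m0 x.+1 &
  forall a, 16 <= a < B \/ B + B <= a -> m a = m0 a].
apply: (@wp_seq (15 * 1) 33) => //.
apply: (@wp_conseq (I3 15)).
  apply: wp_repeat => [j m' lt15 [[f1 f2 f3 f7] [fB fx fa]]|]; last first.
    by split; split; try move=> x lex; sx => //; rewrite ?ex ?ea //; lia.
  step; apply: wp_nil; split; split; try move=> x lex; sx => //; rewrite ?fx ?fa //; lia.
move=> {e0 e1 eB ex ea}m [[e1 e2 e3 e7] [eB ex ea]].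
have {}e3 : m 3 = n by rewrite e3; lia.
apply: (@wp_weaken 4) => //; do 4!step; apply: wp_nil.
split; split; try move=> x lex; sx => //; rewrite ?ex ?ea //; lia.
Qed.

Definition layout (m : memory) : Prop :=
  [/\ m 1 = 1, m 2 = B, m 3 = n, m 4 = B + n & m 5 = B + B] /\
  [/\ m 6 = B + B + B, m B = 0,
   forall i : 'I_n, m (B + i.+1) = parent_code S i &
   forall i : 'I_n, m (B + n + i.+1) = (i \in E')].

(** Frame rule: cell 0, the registers from 7 on and everything from 2B on may be overwritten. *)
Lemma layout_eq m m' : (forall a, 0 < a < 7 \/ B <= a < B + B -> m' a = m a) ->
  layout m -> layout m'.
Proof.
move=> eqm [[e1 e2 e3 e4 e5] [e6 eB eP eE]].
split; split; try (move=> i; have lti := ltn_ord i); rewrite ?eqm ?eP ?eE //; lia.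
Qed.

Lemma relocateP m : spilled m ->
  wp relocate (n * 14 + 6) (fun m' => [/\ layout m', m' 7 = k &
    forall a, B + B <= a -> m' a = 0]) m.
Proof.
case=> [[e1 e2 e3 e4 e5] [e6 e7 eB ex ea]].
apply: (@wp_seq 5 (n * 14 + 1)); first by lia.
do 5!step; apply: wp_nil.
(* The number of input cells from 16 on; truncated to 0 when spilling has already moved
   everything. *)
pose N := n + n - 14.
pose I j (m : memory) := [/\ m 1 = 1, m 2 = B, m 3 = n, m 4 = B + n & m 5 = B + B] /\
  [/\ m 6 = B + B + B, m 7 = k, m B = 0 & [/\ j <= N, m 8 = j, m 9 = 15 + (N - j),
   m 10 = B + 14 + (N - j) &
   (forall x, 0 < x < 15 + (N - j) -> m (B + x) = init_mem S E' k x.+1) /\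
   forall a, 16 <= a < B \/ B + B <= a -> m a = init_mem S E' k a]].
apply: (@wp_conseq (I 0)).
  apply: (@wp_weaken (N * 7).+1); first by lia.
  apply: wp_while => [m' [_ [_ _ _ [_ -> //]]]|j m' |]; last first.
    split; split; last split; last split; try move=> x lex; sx => //; rewrite ?subnn ?ex ?ea //; lia.
  move=> [[f1 f2 f3 f4 f5] [f6 f7 fB [leN f8 f9 f10 [fx fa]]]].
  split; first by rewrite f8.
  do 5!step; apply: wp_nil; rewrite !fa; last by lia.
  split; split; last split; last split; try move=> x lex; sx => //; try lia.
    have [->|ne] := eqVneq x (15 + (N - j.+1)).
      by sx; rewrite addn1.
    sx; rewrite fx //; lia.
  rewrite fa //; lia.
move=> {ex ea} m' [[f1 f2 f3 f4 f5] [f6 f7 fB [_ _ _ _ [fx fa]]]].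
split=> //; last by move=> a lea; rewrite fa ?init_blank //; lia.
split; split=> // i; have ltin := ltn_ord i.
  by rewrite fx ?init_parent //; lia.
by rewrite -addnA fx ?init_initial //; [rewrite -init_initial; congr init_mem|]; lia.
Qed.

Definition node_code (o : option 'I_n) : nat := oapp (fun i : 'I_n => i.+1) 0 o.

Lemma parent_codeE i : parent_code S i = node_code (parent S i).
Proof.
rewrite /parent_code /parent; case: (S i) => [[|s [|? ?]]|] //.
Qed.

Lemma find_originP (v : 'I_n) m : layout m -> m 7 = v.+1 ->
  wp find_origin (n * 9 + 4) (fun m' => [/\ layout m', m' 8 = node_code (origin S E' v) &
    forall a, 0 < a < 8 \/ 11 < a -> m' a = m a]) m.
Proof.
move=> lm m7; have [[e1 e2 e3 e4 e5] [e6 eB eP eE]] := lm.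
apply: (@wp_seq 3 (n * 9).+1); first by lia.
do 3!step; apply: wp_nil.
pose I j (m' : memory) := [/\ j <= n, m' 9 = j,
  m' 8 = node_code (iter (n - j) (climb S E') (Some v)) &
  forall a, 0 < a < 8 \/ 11 < a -> m' a = m a].
apply: (@wp_conseq (I 0)); last first.
  move=> m' [_ _ m8 keep]; rewrite subn0 in m8; split=> //.
  by apply: layout_eq lm => a lea; rewrite keep //; lia.
apply: wp_while => [m' [_ //]|j m' [ltj f9 f8 keep]|]; last first.
  by split=> [|||a lea]; sx => //; rewrite ?subnn ?addn0 //; lia.
have lm' : layout m' by apply: layout_eq lm => a lea; rewrite keep //; lia.
have {lm'} [[f1 f2 f3 f4 f5] [f6 fB fP fE]] := lm'.
split; first by rewrite f9.
have iterE : iter (n - j) (climb S E') (Some v)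
    = climb S E' (iter (n - j.+1) (climb S E') (Some v)).
  by rewrite -iterS; congr iter; lia.
have keepI m'' : m'' 9 = j -> m'' 8 = node_code (climb S E' (iter (n - j.+1) (climb S E') (Some v))) ->
    (forall a, 0 < a < 8 \/ 11 < a -> m'' a = m' a) -> I j m''.
  move=> g9 g8 eqm; split=> //; [exact: ltnW|by rewrite iterE|].
  by move=> a lea; rewrite eqm ?keep.
apply: (@wp_seq 3 4) => //; do 2!step.
case: (iter (n - j.+1) (climb S E') (Some v)) f8 keepI => [i|] f8 keepI.
  have ltin := ltn_ord i; rewrite /= in f8; step; rewrite fE; apply: wp_nil.
  apply: wp_ifz => [|]; sx; rewrite /= in keepI.
    move=> iE; have {}iE : (i \in E') = false by case: (i \in E') iE.
    rewrite iE in keepI; do 2!step; rewrite fP parent_codeE; apply: wp_nil.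
    by apply: keepI => [||a lea]; sx => //; lia.
  move=> iE; have {}iE : i \in E' by case: (i \in E') iE.
  by rewrite iE in keepI; apply: keepI => [||a lea]; sx => //; lia.
(* For code 0 the indicator read is meaningless, but both branches leave 0, since cell B holds 0. *)
rewrite /= in f8 keepI; step; apply: wp_nil.
apply: wp_ifz => [|]; sx => _; last by apply: keepI => [||a lea]; sx => //; lia.
do 2!step; apply: wp_nil.
by apply: keepI => [||a lea]; sx => //; lia.
Qed.

(** The tally once the downward loop over entities has reached [j]. *)
Let W j (i : 'I_n) :=
  \sum_(v : 'I_n | j <= v) ((origin S E' v == Some i) && (i \in E')).

Lemma weighP m : layout m -> m 7 = k -> (forall a, B + B <= a -> m a = 0) ->
  wp weigh (n * (n * 9 + 13) + 5) (fun m' => [/\ layout m', m' 7 = k,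
    forall i : 'I_n, m' (B + B + i.+1) = weight S E' i &
    forall a, B + B + B <= a -> m' a = 0]) m.
Proof.
move=> lm m7 blank; have [[e1 e2 e3 e4 e5] [e6 eB eP eE]] := lm.
apply: (@wp_seq 3 (n * (n * 9 + 13) + 2)); first by lia.
do 3!step; apply: wp_nil.
pose I j (m' : memory) := [/\ layout m', m' 7 = j, m' 12 = k & [/\ j <= n,
  forall i : 'I_n, m' (B + B + i.+1) = W j i &
  forall a, B + B + B <= a -> m' a = 0]].
apply: (@wp_seq (n * (n * 9 + 11).+2).+1 1); first by lia.
apply: (@wp_conseq (I 0)); last first.
  move=> m' [lm' f7 f12 [_ fW fa]]; step; apply: wp_nil; split=> [||i|a lea]; sx; rewrite ?addn0 //.
  - by apply: layout_eq lm' => a lea; sx.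
  - by rewrite fW.
  - by rewrite fa.
apply: wp_while => [m' [_ //]|j m' [lm' f7 f12 [ltj fW fa]]|]; last first.
  split; sx => //; first by apply: layout_eq lm => a lea; sx.
  split=> // [i|a lea]; last by sx; rewrite blank //; lia.
  have ltin := ltn_ord i; sx; rewrite blank; last by lia.
  by rewrite /W big1 // => v; rewrite leqNgt ltn_ord.
split; first by rewrite f7.
apply: (@wp_seq (n * 9 + 4) 7); first by lia.
apply: wp_conseq (@find_originP (Ordinal ltj) _ lm' f7) _ => m1 [lm1 r8 keep].
have [[g1 g2 g3 g4 g5] [g6 gB gP gE]] := lm1.
have WS i : W j i = ((origin S E' (Ordinal ltj) == Some i) && (i \in E')) + W j.+1 i.
  rewrite /W (bigD1 (Ordinal ltj)) //=; congr (_ + _); apply: eq_bigl => v.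
  by rewrite -val_eqE /=; lia.
have g7 : m1 7 = j.+1 by rewrite keep //; lia.
have g12 : m1 12 = k by rewrite keep //; lia.
have gW (i : 'I_n) : m1 (B + B + i.+1) = W j.+1 i by rewrite keep ?fW //; lia.
have ga a : B + B + B <= a -> m1 a = 0 by move=> lea; rewrite keep ?fa //; lia.
case: (origin S E' (Ordinal ltj)) r8 WS => [r|] /= r8 WS.
  have ltrn := ltn_ord r.
  do 2!step; rewrite gE; do 2!step; rewrite gW; do 3!step; apply: wp_nil.
  split; sx; rewrite ?subn1 //; first by apply: layout_eq lm1 => a lea; sx.
  split=> [|i|a lea]; [exact: ltnW| |by sx; rewrite ga].
  have [ri|ri] := eqVneq r i.
    by subst i; sx; rewrite WS eqxx addnC.
  rewrite WS (inj_eq Some_inj) (negbTE ri); have ltin := ltn_ord i.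
  have neq : (r : nat) != i by []; sx; exact: gW.
(* Without an origin, the addition goes to cell 2B, which is no entity's weight. *)
do 7!step; apply: wp_nil.
split; sx; rewrite ?subn1 //; first by apply: layout_eq lm1 => a lea; sx.
split=> [|i|a lea]; [exact: ltnW| |by sx; rewrite ga].
by have ltin := ltn_ord i; sx; rewrite WS gW.
Qed.

Lemma find_maxP (w : 'I_n -> nat) m : layout m ->
  (forall i : 'I_n, m (B + B + i.+1) = w i) ->
  wp find_max (n * 10 + 5) (fun m' => (forall a, 0 < a < 8 \/ 11 < a -> m' a = m a) /\
    exists2 x : 'I_n, m' 10 = x.+1 & forall i, w i <= w x) m.
Proof.
move=> lm mw; have [[e1 e2 e3 e4 e5] [e6 eB eP eE]] := lm.
apply: (@wp_seq 4 (n * 10).+1); first by lia.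
do 4!step; apply: wp_nil.
pose I j (m' : memory) := [/\ j <= n, m' 8 = j,
  forall a, 0 < a < 8 \/ 11 < a -> m' a = m a,
  forall i : 'I_n, j <= i -> w i <= m' 9 &
  (j = n /\ m' 9 = 0) \/ exists2 x : 'I_n, m' 10 = x.+1 & m' 9 = w x].
apply: (@wp_conseq (I 0)); last first.
  move=> m' [_ _ keep maxw [[n0]|[x m10 m9]]]; first by lia.
  by split=> //; exists x => // i; rewrite -m9 maxw.
apply: wp_while => [m' [_ //]|j m' [ltj f8 keep maxw argw]|]; last first.
  split=> [||a lea|i|]; sx => //; try lia.
  by rewrite leqNgt ltn_ord.
split; first by rewrite f8.
have f1 : m' 1 = 1 by rewrite keep //; lia.
have f5 : m' 5 = B + B by rewrite keep //; lia.
have f11 : m' (B + B + j.+1) = w (Ordinal ltj) by rewrite keep ?(mw (Ordinal ltj)) //; lia.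
apply: (@wp_seq 3 5) => //; do 3!step; apply: wp_nil.
apply: (@wp_seq 4 1) => //; apply: wp_ifz => [|]; sx.
  (* Ties also update, so the first test always sets cell 10, even if all weights are 0. *)
  move=> le9; do 2!step; apply: wp_nil; step; apply: wp_nil.
  rewrite le9 !addn0; split=> [||a lea|i|]; sx => //; try lia.
  - by rewrite keep.
  - have [->//|ne] := eqVneq i (Ordinal ltj).
    by move=> lei; have := maxw i; move: ne; rewrite -val_eqE /=; lia.
  - by right; exists (Ordinal ltj); sx.
move=> lt9; step; apply: wp_nil; split=> [||a lea|i|]; sx => //; try lia.
- by rewrite keep.
- have [->//|ne] := eqVneq i (Ordinal ltj); first by lia.
  by move=> lei; have := maxw i; move: ne; rewrite -val_eqE /=; lia.
- case: argw => [[_ m9]|[x m10 m9]]; first by lia.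
  by right; exists x; sx.
Qed.

Lemma selectP m : layout m -> m 7 = k ->
  (forall i : 'I_n, m (B + B + i.+1) = weight S E' i) ->
  (forall a, B + B + B <= a -> m a = 0) ->
  wp select (k * (n * 10 + 13)).+1 (fun m' => [/\ layout m', m' 7 = 0 &
    exists2 H : {set 'I_n}, heaviest S E' k H &
      forall i : 'I_n, m' (B + B + B + i.+1) = (i \in H)]) m.
Proof.
move=> lm m7 mw blank.
pose I j (m' : memory) := [/\ layout m', m' 7 = j, j <= k &
  exists H : {set 'I_n}, [/\ heaviest S E' (k - j) H,
    forall i : 'I_n, m' (B + B + i.+1) = (i \notin H) * weight S E' i &
    forall i : 'I_n, m' (B + B + B + i.+1) = (i \in H)]].
apply: (@wp_conseq (I 0)); last first.
  by move=> m' [lm' f7 _ [H [optH _ mH]]]; split=> //; exists H; rewrite ?subn0 in optH *.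
apply: (@wp_weaken (k * (n * 10 + 11).+2).+1); first by rewrite -addn2 -addnA.
apply: wp_while => [m' [_ //]|j m' [lm' f7 ltj [H [optH fw fH]]]|]; last first.
  split=> //; exists set0; split=> [|i|i]; rewrite ?subnn ?inE ?mul1n ?mw ?blank //.
    exact: heaviest0.
  by lia.
split; first by rewrite f7.
apply: (@wp_seq (n * 10 + 5) 6); first by lia.
apply: wp_conseq (find_maxP lm' fw) _ => m1 [keep [x r10 maxx]].
have lm1 : layout m1 by apply: layout_eq lm' => a lea; rewrite keep //; lia.
have [[g1 g2 g3 g4 g5] [g6 gB gP gE]] := lm1.
have g7 : m1 7 = j.+1 by rewrite keep //; lia.
have ltxn := ltn_ord x.
do 6!step; apply: wp_nil; split; sx; rewrite ?subn1 //; last 1 first.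
- exists (x |: H); split=> [|i|i].
  + have -> : k - j = (k - j.+1).+1 by lia.
    exact: heaviestS.
  + have ltin := ltn_ord i; rewrite !inE; have [->|ne] := eqVneq i x; sx => //.
    have {}ne : (i : nat) != x by []; sx.
    by rewrite keep ?fw //; lia.
  + have ltin := ltn_ord i; rewrite !inE; have [->|ne] := eqVneq i x; sx => //.
    have {}ne : (i : nat) != x by []; sx.
    by rewrite keep ?fH //; lia.
- by apply: layout_eq lm1 => a lea; sx.
- exact: ltnW.
Qed.

Lemma outputP (H : {set 'I_n}) m : layout m -> m 7 = 0 ->
  (forall i : 'I_n, m (B + B + B + i.+1) = (i \in H)) ->
  wp output (n * 8 + 5) (fun m' => H_out n m' = H) m.
Proof.
move=> [[e1 e2 e3 e4 e5] [e6 eB eP eE]] m7 mH.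
apply: (@wp_seq 4 (n * 8).+1); first by lia.
do 4!step; apply: wp_nil.
pose I j (m' : memory) := [/\ j <= n, m' 2 = j, m' 0 = B + B + B + (n - j),
  m' 1 = 1 + n + n + (n - j) &
  (forall i : 'I_n, m' (B + B + B + i.+1) = (i \in H)) /\
  forall i : 'I_n, i < n - j -> m' (2 + n + n + i) = (i \in H)].
apply: (@wp_conseq (I 0)); last first.
  move=> m' [_ _ _ _ [_ mO]]; apply/setP => i.
  by rewrite inE mO ?subn0 //; case: (i \in H).
apply: wp_while => [m' [_ //]|j m' [ltj f2 f0 f1 [fH fO]]|]; last first.
  split; sx; rewrite ?subnn ?addn0 //; split=> // i; have ltin := ltn_ord i.
  by sx; exact: mH.
split; first by rewrite f2.
have ltn' : n - j.+1 < n by lia.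
do 5!step.
have -> : B + B + B + (n - j.+1) + 1 = B + B + B + (Ordinal ltn').+1 by rewrite /=; lia.
rewrite fH; step; apply: wp_nil; split; sx => //=; try lia.
split=> i; have ltin := ltn_ord i; first by sx; exact: fH.
move=> lti; have [->|ne] := eqVneq i (Ordinal ltn').
  by rewrite /=; sx.
have {}ne : (i : nat) != n - j.+1 by [].
by sx; rewrite fO //; lia.
Qed.

Definition hardening_code : code :=
  seqc spill (seqc relocate (seqc weigh (seqc select output))).

Lemma hardeningP : caseI S -> wp hardening_code (100 * n.+1 ^ 2)
  (fun m => optimal_hardening S E' k (H_out n m)) (init_mem S E' k).
Proof.
move=> S1.
pose T4 := n * 8 + 5; pose T3 := (k * (n * 10 + 13)).+1.
pose T2 := n * (n * 9 + 13) + 5; pose T1 := n * 14 + 6.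
(* Here k < n bounds the selection phase and excludes n = 0. *)
apply: (@wp_seq 100 (T1 + (T2 + (T3 + T4)))); first by rewrite /T1 /T2 /T3 /T4; nia.
apply: wp_conseq spillP _ => m1 Hm1.
apply: (@wp_seq T1 (T2 + (T3 + T4))) => //.
apply: wp_conseq (relocateP Hm1) _ => m2 [l2 k2 z2].
apply: (@wp_seq T2 (T3 + T4)) => //.
apply: wp_conseq (weighP l2 k2 z2) _ => m3 [l3 k3 w3 z3].
apply: (@wp_seq T3 T4) => //.
apply: wp_conseq (selectP l3 k3 w3 z3) _ => m4 [l4 k4 [H optH mH]].
apply: wp_conseq (outputP l4 k4 mH) _ => m5 ->.
exact: heaviest_optimal.
Qed.

End Verification.

Theorem theorem2 :
  exists (prog : seq instr) (c d : nat),
    forall (n : nat) (S : system n) (E' : {set 'I_n}) (k : nat),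
      caseI S -> k < #|E'| ->
      exists2 m : nat -> nat,
        run (c * n.+1 ^ d) prog 0 (init_mem S E' k) = Some m &
        optimal_hardening S E' k (H_out n m).
Proof.
exists (hardening_code 0), 100, 2 => n S E' k S1 kE.
exact: wp_run (leqnn _) (hardeningP kE erefl S1).
Qed.
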